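(* Let $\ell(Z,\theta)=\mathcal L\big(\theta^\top Y\theta+2z^\top\theta+z^0\big)$ for $Z=(Y,z,z^0)\in\mathbb S^d\times\mathbb R^d\times\mathbb R$ and $\theta\in\Theta\subseteq\mathbb R^d$, where $\mathcal L:\mathbb R\to\mathbb R$ is $L$-Lipschitz continuous. Let $\theta_t\in\Theta$, and let $\mathbb B(\hat{\mathbb P}(\theta_t))$ be the type-1 Wasserstein ball of radius $\rho\ge 0$ around $\hat{\mathbb P}(\theta_t)$ with ground cost given by the Schatten-$\infty$ norm. Then the robust risk minimization problem $$\min_{\theta\in\Theta}\ \sup_{\mathbb Q\in\mathbb B(\hat{\mathbb P}(\theta_t))}\mathbb E_{\mathbb Q}[\ell(\tilde Z,\theta)]$$ is equivalent to the Tikhonov regularized problem $$\inf_{\theta\in\Theta}\ \mathbb E_{\hat{\mathbb P}(\theta_t)}\Big[\mathcal L\big(\theta^\top\tilde Y\theta+2\tilde z^\top\theta+\tilde z^0\big)\Big]+\rho L\,\|(\theta,1)\|_2^2 .$$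
   Context: $\mathbb S^n$ is the space of real symmetric $n\times n$ matrices. A triple $Z=(Y,z,z^0)$ is identified with the matrix $\begin{bmatrix}Y&z\\ z^\top&z^0\end{bmatrix}\in\mathbb S^{d+1}$, and the support $\mathcal Z$ of the random parameter $\tilde Z=(\tilde Y,\tilde z,\tilde z^0)$ is the whole space $\mathbb S^{d+1}$. Standing assumption: for every fixed $Z\in\mathcal Z$, the loss $\theta\mapsto\ell(Z,\theta)$ is convex. For each decision $\theta\in\Theta$ the reference distribution is finitely supported: $\hat{\mathbb P}(\theta)=\sum_{s=1}^S\hat p_s(\theta)\,\delta_{\hat Z_s(\theta)}$, with scenarios $\hat Z_s(\theta)\in\mathcal Z$ and probabilities $\hat p_s(\theta)\ge 0$ summing to $1$. The Schatten-$\infty$ norm $\|A\|_\infty$ is the largest singular value of $A$. The type-1 Wasserstein distance is $W_1(\mathbb Q_1,\mathbb Q_2)=\inf_\pi\int\|Z_1-Z_2\|_\infty\,\pi(\mathrm dZ_1,\mathrm dZ_2)$, the infimum being over couplings $\pi$ of $\mathbb Q_1$ and $\mathbb Q_2$. The ball $\mathbb B(\hat{\mathbb P}(\theta_t))$ is the set of all probability distributions $\mathbb Q$ on $\mathcal Z$ with finite first moment and $W_1(\mathbb Q,\hat{\mathbb P}(\theta_t))\le\rho$.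
   Formalization: L is taken to be the least Lipschitz constant of the loss function 𝓛 (with a larger L the claim fails, e.g. 𝓛 = 0, L = 1, ρ > 0); d ≥ 1 is assumed, and the convexity assumption is the standing one on all of R^d or, more generally, convexity of 𝓛. *)

(* Defs.v *)
From HB Require Import structures.
From mathcomp Require Import all_boot all_order all_algebra.
From mathcomp Require Import all_classical all_reals all_analysis.

Set Implicit Arguments.
Unset Strict Implicit.
Unset Printing Implicit Defensive.

Import Order.TTheory GRing.Theory Num.Theory.
Import numFieldNormedType.Exports.

Local Open Scope classical_set_scope.
Local Open Scope ring_scope.

(** * Real symmetric matrices *)

Record symmx (R : realType) (n : nat) :=
  SymMx { mxval :> 'M[R]_n; _ : mxval^T == mxval }.

HB.instance Definition _ (R : realType) (n : nat) :=
  [isSub of symmx R n for @mxval R n].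
HB.instance Definition _ (R : realType) (n : nat) :=
  [Choice of symmx R n by <:].

Lemma symmx0_subproof (R : realType) (n : nat) : (0 : 'M[R]_n)^T == 0.
Proof. by rewrite trmx0. Qed.

HB.instance Definition _ (R : realType) (n : nat) :=
  isPointed.Build (symmx R n) (SymMx (symmx0_subproof R n)).

(* Euclidean topology, induced by the inclusion into the space of matrices. *)
HB.instance Definition _ (R : realType) (n : nat) :=
  Topological.copy (symmx R n) (initial_topology (@mxval R n)).

Definition borel_symmx (R : realType) (n : nat) : Type :=
  g_sigma_algebraType (@open (symmx R n)).

HB.instance Definition _ (R : realType) (n : nat) :=
  Measurable.copy (borel_symmx R n) (g_sigma_algebraType (@open (symmx R n))).

(** * Norms *)

Definition norm2 (R : realType) (n : nat) (v : 'cV[R]_n) : R :=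
  Num.sqrt (\sum_i v i 0 ^+ 2).

Definition singular_value (R : realType) (n : nat) (A : 'M[R]_n) (s : R) :=
  0 <= s /\ eigenvalue (A^T *m A) (s ^+ 2).

(* For n > 0 the set of singular values is finite and nonempty, so that the
   supremum is a maximum. *)
Definition schatten_infty (R : realType) (n : nat) (A : 'M[R]_n) : R :=
  sup [set s | singular_value A s].

(** * Wasserstein distance of type 1 *)

Section wasserstein.
Context {R : realType} {n : nat}.
Local Notation T := (borel_symmx R n).
Local Open Scope ereal_scope.

Definition coupling (Q1 Q2 : probability T R) (pi : probability (T * T)%type R) :=
  forall A : set T, measurable A ->
    pi (A `*` setT) = Q1 A /\ pi (setT `*` A) = Q2 A.

Definition W1 (Q1 Q2 : probability T R) : \bar R :=
  ereal_inf [set \int[pi]_x (schatten_infty (mxval x.1 - mxval x.2))%:E |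
             pi in coupling Q1 Q2].

Definition finite_first_moment (Q : probability T R) :=
  \int[Q]_Z (schatten_infty (mxval Z))%:E < +oo.

Definition wasserstein_ball (rho : R) (P : probability T R) :
    set (probability T R) :=
  [set Q | finite_first_moment Q /\ W1 Q P <= rho%:E].

End wasserstein.

(** * Losses *)

(* The matrix [[Y, z], [z^T, z0]] stands for the triple (Y, z, z0). *)
Section triple.
Context {R : realType} {d : nat}.
Implicit Type Z : symmx R (d + 1).

Definition Ypart Z : 'M[R]_d := ulsubmx (mxval Z).
Definition zpart Z : 'cV[R]_d := ursubmx (mxval Z).
Definition z0part Z : R := drsubmx (mxval Z) 0 0.

End triple.

Definition quad_loss (R : realType) (d : nat) (calL : R -> R)
    (Z : symmx R (d + 1)) (theta : 'cV[R]_d) : R :=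
  calL ((theta^T *m Ypart Z *m theta) 0 0
        + 2 * ((zpart Z)^T *m theta) 0 0 + z0part Z).

(* With an arbitrary, possibly non-optimal Lipschitz constant L, the
   regularizer rho * L * |(theta, 1)|^2 would only bound the worst-case risk
   from above. *)
Definition lipschitz_modulus (R : realType) (f : R -> R) (L : R) :=
  L.-lipschitz f /\ forall K : R, K.-lipschitz f -> L <= K.

(** * The two optimization problems *)

Section problems.
Context {R : realType} {d : nat}.
Local Notation T := (borel_symmx R (d + 1)).
Local Open Scope ereal_scope.

Definition robust_risk (calL : R -> R) (rho : R) (P : probability T R)
    (theta : 'cV[R]_d) : \bar R :=
  ereal_sup [set 'E_Q[fun Z : T => quad_loss calL Z theta] |
             Q in wasserstein_ball rho P].

Definition tikhonov_risk (calL : R -> R) (L rho : R) (P : probability T R)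
    (theta : 'cV[R]_d) : \bar R :=
  'E_P[fun Z : T => quad_loss calL Z theta]
  + (rho * L * norm2 (col_mx theta (1%:M : 'cV[R]_1)) ^+ 2)%:E.

Definition optimal_value (Theta : set 'cV[R]_d) (F : 'cV[R]_d -> \bar R) :
    \bar R :=
  ereal_inf [set F theta | theta in Theta].

Definition minimizers (Theta : set 'cV[R]_d) (F : 'cV[R]_d -> \bar R) :
    set 'cV[R]_d :=
  [set theta | Theta theta /\
               forall theta', Theta theta' -> F theta <= F theta'].

(* "Equivalent" minimization problems: same feasible set, same objective on
   it, hence same optimal value and same solutions; the infima need not be
   attained. *)
Definition equivalent_problems (Theta : set 'cV[R]_d)
    (F G : 'cV[R]_d -> \bar R) :=
  [/\ {in Theta, F =1 G},
      optimal_value Theta F = optimal_value Theta G &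
      minimizers Theta F = minimizers Theta G].

End problems.

(* Main.v *)
Require Import Defs.
From HB Require Import structures.
From mathcomp Require Import all_boot all_order all_algebra ring lra.
From mathcomp Require Import all_classical all_reals all_analysis.
From mathcomp Require Import measurable_realfun.

Set Implicit Arguments.
Unset Strict Implicit.

Import Order.TTheory GRing.Theory Num.Theory.
Import numFieldNormedType.Exports.
Local Open Scope classical_set_scope.
Local Open Scope ring_scope.

(** With [u = (theta, 1)] the loss is [calL (u Z u^T)]: the decision enters
    through a quadratic form that is linear in the uncertain matrix [Z]. Since
    [|u A u^T| <= |u|^2 * schatten_infty A] ([schatten_quad]), with equality
    when [A] is a multiple of the rank-one matrix [u^T u], the loss is
    Lipschitz in [Z] with constant [L * |u|^2].

    Upper bound. Integrating the Lipschitz estimate against an almost optimal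
    coupling of [Q] and [P] gives [E_Q <= E_P + L * |u|^2 * W1 Q P]
    ([wasserstein_lipschitz]).

    Lower bound. A convex function whose best Lipschitz constant is [L] lies
    above affine functions whose slope [k] has [|k|] arbitrarily close to [L]
    ([steep_minorant]). Move a fraction [t] of the mass of [P] by the rank-one
    matrix [(+- rho / (t * |u|^2)) u^T u], the sign being that of [k]: this
    costs at most [rho] ([W1_perturbation]). The mass that moves contributes at
    least [t * (k * E_P[u Z u^T] - C) + |k| * rho * |u|^2], the mass that stays
    [(1 - t) * E_P]. As [t] tends to [0] the total approaches
    [E_P + |k| * rho * |u|^2] ([worst_case_approx]).

    Both bounds hold around every [P] with a finite first moment
    ([strong_duality]), in particular around finitely supported ones
    ([finite_support_moment]). The two objectives therefore coincide as
    functions of [theta], and so do optimal values and minimizers.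

    The integral of a nonnegative function is a supremum over simple functions
    below it, hence monotone without measurability ([ge0_le_integralT]). The
    Schatten norm is compared under the integral sign with measurable
    functions: absolute values of entries and of quadratic forms from below,
    the Frobenius norm and the sum of absolute values of entries from above. *)

(** * The Schatten norm as an operator norm *)

Section matrices.
Context {R : realType}.

Definition bil {m n : nat} (B : 'M[R]_(m, n)) (u : 'rV[R]_m) (v : 'rV[R]_n) : R :=
  (u *m B *m v^T) 0 0.

Definition sqnorm {n : nat} (u : 'rV[R]_n) : R := \sum_i u 0 i ^+ 2.

Definition sqfrob {m n : nat} (A : 'M[R]_(m, n)) : R := \sum_i \sum_j A i j ^+ 2.

Lemma sqnorm_ge0 n (u : 'rV[R]_n) : 0 <= sqnorm u.
Proof. by apply: sumr_ge0 => i _; exact: sqr_ge0. Qed.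

Lemma sqfrob_ge0 m n (A : 'M[R]_(m, n)) : 0 <= sqfrob A.
Proof. by apply: sumr_ge0 => i _; apply: sumr_ge0 => j _; exact: sqr_ge0. Qed.

Lemma sqnorm_eq0 n (u : 'rV[R]_n) : (sqnorm u == 0) = (u == 0).
Proof.
apply/idP/eqP => [|->]; last first.
  by rewrite /sqnorm big1// => i _; rewrite mxE expr0n.
rewrite psumr_eq0; last by move=> i _; exact: sqr_ge0.
move=> /allP h; apply/rowP => i; rewrite mxE.
by have := h i (mem_index_enum _); rewrite /= sqrf_eq0 => /eqP.
Qed.

Lemma sqfrob_tr m n (A : 'M[R]_(m, n)) : sqfrob A^T = sqfrob A.
Proof.
rewrite /sqfrob exchange_big; apply: eq_bigr => i _; apply: eq_bigr => j _.
by rewrite mxE.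
Qed.

Lemma bil_scalar n a (u v : 'rV[R]_n) :
  bil a%:M u v = a * \sum_i u 0 i * v 0 i.
Proof.
rewrite /bil mul_mx_scalar -scalemxAl mxE mxE; congr (_ * _).
by apply: eq_bigr => i _; rewrite mxE.
Qed.

Lemma bil1 n (u : 'rV[R]_n) : bil 1%:M u u = sqnorm u.
Proof. by rewrite bil_scalar mul1r. Qed.

Lemma bil_mull m n p (A : 'M[R]_(m, n)) (B : 'M[R]_(n, p)) u v :
  bil B (u *m A) v = bil (A *m B) u v.
Proof. by rewrite /bil !mulmxA. Qed.

Lemma bil_mulr m n p (A : 'M[R]_(m, n)) (B : 'M[R]_(p, n)) u v :
  bil A u (v *m B) = bil (A *m B^T) u v.
Proof. by rewrite /bil trmx_mul !mulmxA. Qed.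

Lemma bilDl m n (B : 'M[R]_(m, n)) u1 u2 v :
  bil B (u1 + u2) v = bil B u1 v + bil B u2 v.
Proof. by rewrite /bil !mulmxDl [LHS]mxE. Qed.

Lemma bilDr m n (B : 'M[R]_(m, n)) u v1 v2 :
  bil B u (v1 + v2) = bil B u v1 + bil B u v2.
Proof. by rewrite /bil raddfD/= mulmxDr mxE. Qed.

Lemma bilZl m n (B : 'M[R]_(m, n)) a u v : bil B (a *: u) v = a * bil B u v.
Proof. by rewrite /bil -!scalemxAl mxE. Qed.

Lemma bilZr m n (B : 'M[R]_(m, n)) a u v : bil B u (a *: v) = a * bil B u v.
Proof. by rewrite /bil linearZ/= -scalemxAr mxE. Qed.

Lemma bilB m n (B C : 'M[R]_(m, n)) u v : bil (B - C) u v = bil B u v - bil C u v.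
Proof. by rewrite /bil mulmxBr mulmxBl [LHS]mxE [X in _ + X]mxE. Qed.

Lemma bil_sym n (B : 'M[R]_n) u v : B^T = B -> bil B u v = bil B v u.
Proof.
move=> BT; rewrite /bil; transitivity ((u *m B *m v^T)^T 0 0); first by rewrite [RHS]mxE.
by rewrite !trmx_mul trmxK BT mulmxA.
Qed.

(** The quadratic polynomial [t |-> B(u + t v, u + t v)] is nonnegative, so its
    discriminant is nonpositive. *)
Lemma psd_cauchy_schwarz n (B : 'M[R]_n) : B^T = B ->
  (forall u, 0 <= bil B u u) ->
  forall u v, bil B u v ^+ 2 <= bil B u u * bil B v v.
Proof.
move=> BT B0 u v.
have h t : 0 <= bil B u u + 2 * t * bil B u v + t ^+ 2 * bil B v v.
  have := B0 (u + t *: v); rewrite !(bilDl, bilDr, bilZl, bilZr).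
  rewrite (bil_sym v u BT); set x := (X in 0 <= X -> _); move=> h.
  by rewrite [leRHS](_ : _ = x)// /x; ring.
have := B0 v; rewrite le_eqVlt => /predU1P[v0|v0].
  rewrite -v0 mulr0; have [->|uv0] := eqVneq (bil B u v) 0; first by rewrite expr0n.
  (* Here the polynomial is affine in [t], and it is [-1] at this value. *)
  have := h (- (bil B u u + 1) / (2 * bil B u v)).
  rewrite -v0 mulr0 addr0 [X in _ + X](_ : _ = - (bil B u u + 1)); last by field.
  by rewrite opprD addrA subrr add0r oppr_ge0 ler10.
(* The minimum of the polynomial. *)
have := h (- bil B u v / bil B v v).
rewrite [leRHS](_ : _ = (bil B u u * bil B v v - bil B u v ^+ 2) / bil B v v).
  by rewrite pmulr_lge0 ?invr_gt0// subr_ge0.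
by field; rewrite gt_eqF.
Qed.

Lemma cauchy_schwarz n (u v : 'rV[R]_n) :
  (\sum_i u 0 i * v 0 i) ^+ 2 <= sqnorm u * sqnorm v.
Proof.
have w0 (w : 'rV[R]_n) : 0 <= bil 1%:M w w by rewrite bil1 sqnorm_ge0.
by have := psd_cauchy_schwarz (trmx1 _ _) w0 u v; rewrite !bil1 bil_scalar mul1r.
Qed.

(** Cauchy-Schwarz applied to each column of [A]. *)
Lemma sqnorm_mul m n (A : 'M[R]_(m, n)) u : sqnorm (u *m A) <= sqnorm u * sqfrob A.
Proof.
rewrite -sqfrob_tr /sqfrob mulr_sumr; apply: ler_sum => j _.
have := cauchy_schwarz u (row j A^T).
rewrite [sqnorm (row _ _)](_ : _ = \sum_i A^T j i ^+ 2); last first.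
  by apply: eq_bigr => i _; rewrite mxE.
by rewrite mxE; under eq_bigr do rewrite !mxE.
Qed.

(** The constant is [sqfrob B + 1], an upper bound of the Frobenius norm that
    avoids a square root. *)
Lemma bil_bound n (B : 'M[R]_n) u :
  bil B u u <= sqnorm u * (sqfrob B + 1).
Proof.
have : bil B u u ^+ 2 <= (sqnorm u) ^+ 2 * sqfrob B.
  have -> : bil B u u = \sum_i (u *m B) 0 i * u 0 i.
    by rewrite /bil mxE; apply: eq_bigr => i _; rewrite [u^T _ _]mxE.
  apply: (le_trans (cauchy_schwarz _ _)).
  rewrite expr2 mulrAC; apply: ler_wpM2r; [exact: sqnorm_ge0|exact: sqnorm_mul].
have := sqnorm_ge0 u; have := sqfrob_ge0 B; move: (sqnorm _) (sqfrob _) (bil _ _ _).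
move=> a f b f0 a0 h; have [b0|b0] := leP b 0.
  by apply: (le_trans b0); apply: mulr_ge0 => //; lra.
rewrite -(@ler_pXn2r _ 2)// ?nnegrE ?(ltW b0)//; last by apply: mulr_ge0 => //; lra.
apply: (le_trans h); rewrite exprMn ler_wpM2l ?sqr_ge0//; nra.
Qed.

(** The supremum [l] of the Rayleigh quotient is an eigenvalue, which is shown
    without compactness of the sphere. If it is not, then [C = l - B] is
    positive semidefinite and invertible; Cauchy-Schwarz for the form of [C],
    applied to [u] and [u C], bounds [|u C|^2] by a multiple of [u C u^T], and
    invertibility bounds [|u|^2] by a multiple of [|u C|^2]. Hence the form of
    [C] is bounded below on the unit sphere by some [G^-1 > 0], and [l - G^-1]
    is still an upper bound of the quotient. *)
Lemma rayleigh n (B : 'M[R]_n) : (0 < n)%N -> B^T = B ->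
  exists2 a, eigenvalue B a & forall u, bil B u u <= a * sqnorm u.
Proof.
move=> n0 BT; pose E := [set bil B u u | u in [set u | sqnorm u = 1]].
have E0 : E !=set0.
  case: n n0 B BT @E => // n _ B _.
  exists (bil B (delta_mx 0 0) (delta_mx 0 0)); exists (delta_mx 0 0) => //=.
  rewrite /sqnorm (bigD1 0)//= mxE !eqxx expr1n big1 ?addr0// => i i0.
  by rewrite mxE eqxx (negbTE i0) expr0n.
have ubE : has_ubound E.
  by exists (sqfrob B + 1) => _ [u u1 <-]; have := bil_bound B u; rewrite u1 mul1r.
have bnd c : (forall u, sqnorm u = 1 -> bil B u u <= c) ->
    forall u, bil B u u <= c * sqnorm u.
  move=> h u; have [->|u0] := eqVneq u 0.
    by rewrite /bil !mul0mx mxE (eqP (_ : sqnorm 0 == 0)) ?sqnorm_eq0// mulr0.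
  have su0 : 0 < sqnorm u by rewrite lt_neqAle sqnorm_ge0 andbT eq_sym sqnorm_eq0.
  pose k := Num.sqrt (sqnorm u).
  have k2 : k ^+ 2 = sqnorm u by rewrite sqr_sqrtr// ltW.
  have k0 : k != 0 by rewrite gt_eqF// sqrtr_gt0.
  have := h (k^-1 *: u).
  have -> : sqnorm (k^-1 *: u) = k ^- 2 * sqnorm u.
    by rewrite -!bil1 bilZl bilZr; field.
  rewrite -k2 mulVf ?expf_neq0// => /(_ erefl).
  rewrite bilZl bilZr mulrA -expr2 mulrC exprVn ler_pdivrMr ?k2//.
set l := sup E.
have Bl : forall u, bil B u u <= l * sqnorm u.
  by apply: bnd => u u1; apply: ub_le_sup => //; exists u.
exists l => //; apply: contraT => nl.
pose C := l%:M - B.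
have CT : C^T = C by rewrite /C raddfB/= tr_scalar_mx BT.
have bilC u : bil C u u = l * sqnorm u - bil B u u by rewrite bilB bil_scalar.
have C0 u : 0 <= bil C u u by rewrite bilC subr_ge0.
have CU : C \in unitmx.
  rewrite -row_free_unit -kermx_eq0; move: nl; rewrite /eigenvalue /eigenspace negbK.
  move=> /eqP nl; apply/eqP/row_matrixP => i; rewrite row0.
  have : row i (kermx C) *m C = 0 by rewrite -row_mul mulmx_ker row0.
  move: (row i _) => w wC; apply/eqP; rewrite -submx0 -[X in (_ <= X)%MS]nl.
  by apply/sub_kermxP; rewrite -opprB mulmxN wC oppr0.
pose F := sqfrob C + 1; pose G := sqfrob (invmx C) * F + 1.
have F0 : 0 < F by rewrite ltr_pwDr ?sqfrob_ge0.
have G0 : 0 < G.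
  by rewrite ltr_pwDr ?mulr_ge0 ?sqfrob_ge0 ?ltW.
have uC u : sqnorm (u *m C) <= F * bil C u u.
  have := psd_cauchy_schwarz CT C0 u (u *m C).
  rewrite {1}bil_mulr CT -{1}[C in C *m _]mulmx1 -mulmxA.
  have -> : bil (C *m (1%:M *m C)) u u = sqnorm (u *m C).
    by rewrite -bil1 bil_mull bil_mulr CT mulmxA.
  move=> h; have [->|s0] := eqVneq (sqnorm (u *m C)) 0.
    by rewrite mulr_ge0// ltW.
  have s1 : 0 < sqnorm (u *m C) by rewrite lt_neqAle sqnorm_ge0 andbT eq_sym.
  rewrite -(ler_pM2r s1) -expr2 (le_trans h)// mulrC [leRHS]mulrAC.
  by apply: ler_wpM2r => //; rewrite mulrC bil_bound.
have key u : sqnorm u <= G * bil C u u.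
  have /le_trans -> // : sqnorm u <= sqnorm (u *m C) * sqfrob (invmx C).
    by rewrite -{1}(mulmxK CU u) sqnorm_mul.
  rewrite mulrC (@le_trans _ _ (sqfrob (invmx C) * (F * bil C u u)))//.
    by rewrite ler_wpM2l// sqfrob_ge0.
  by rewrite /G [leRHS]mulrDl mulrA mul1r lerDl.
have : l <= l - G^-1.
  apply: ge_sup => // _ [u /= u1 <-].
  by have := key u; rewrite bilC u1 mulr1 mulrC -ler_pdivrMr// mul1r lerBrDl -lerBrDr.
by rewrite lerDl oppr_ge0 leNgt invr_gt0 G0.
Qed.

Lemma singular_value_le n (A : 'M[R]_n) s :
  singular_value A s -> s ^+ 2 <= sqfrob A.
Proof.
move=> [s0 /eigenvalueP[v vA v0]].
have v1 : 0 < sqnorm v by rewrite lt_neqAle sqnorm_ge0 andbT eq_sym sqnorm_eq0.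
rewrite -(ler_pM2r v1) [leRHS]mulrC -sqfrob_tr.
apply: le_trans (sqnorm_mul _ _).
rewrite -!bil1 bil_mull bil_mulr mulmx1 trmxK -bilZl -vA bil_mull mulmx1//.
Qed.

Lemma singular_value_le_frob n (A : 'M[R]_n) s :
  singular_value A s -> s <= Num.sqrt (sqfrob A).
Proof.
move=> As; rewrite -(ger0_norm (proj1 As)) -sqrtr_sqr ler_sqrt ?sqfrob_ge0//.
exact: singular_value_le.
Qed.

Lemma singular_value_le_schatten n (A : 'M[R]_n) s :
  singular_value A s -> s <= schatten_infty A.
Proof.
move=> As; apply: ub_le_sup => //.
by exists (Num.sqrt (sqfrob A)) => t; exact: singular_value_le_frob.
Qed.

Lemma schatten_ge0 n (A : 'M[R]_n) : 0 <= schatten_infty A.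
Proof.
have [[s As]|E0] := pselect ([set s | singular_value A s] !=set0).
  exact: le_trans (proj1 As) (singular_value_le_schatten As).
by rewrite /schatten_infty (_ : [set s | _] = set0) ?sup0//; apply/nonemptyPn.
Qed.

Lemma schatten_le_frob n (A : 'M[R]_n) : schatten_infty A <= Num.sqrt (sqfrob A).
Proof.
have [E0|E0] := pselect ([set s | singular_value A s] !=set0).
  by apply: ge_sup => // s; exact: singular_value_le_frob.
rewrite /schatten_infty (_ : [set s | _] = set0) ?sup0 ?sqrtr_ge0//.
exact/nonemptyPn.
Qed.

(** [rayleigh] applied to [A^T A]: the maximum of [|A u|^2] on the unit sphere
    is the square of a singular value. *)
Lemma schatten_opnorm n (A : 'M[R]_n) u :
  sqnorm (u *m A^T) <= schatten_infty A ^+ 2 * sqnorm u.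
Proof.
case: n A u => [|n] A u; first by rewrite {1}/sqnorm big_ord0 mulr_ge0 ?sqr_ge0 ?sqnorm_ge0.
have [|a aA ha] := @rayleigh n.+1 (A^T *m A) isT; first by rewrite trmx_mul trmxK.
have AA w : bil (A^T *m A) w w = sqnorm (w *m A^T).
  by rewrite -bil1 bil_mull mulmx1 bil_mulr trmxK.
have a0 : 0 <= a.
  have /eigenvalueP[v vA v0] := aA.
  have v1 : 0 < sqnorm v by rewrite lt_neqAle sqnorm_ge0 andbT eq_sym sqnorm_eq0.
  rewrite -(pmulr_lge0 _ v1) -bil1 -bilZl -vA bil_mull mulmx1 AA sqnorm_ge0//.
rewrite -AA (le_trans (ha u))// ler_wpM2r ?sqnorm_ge0//.
rewrite -{1}(sqr_sqrtr a0) ler_pXn2r ?nnegrE ?sqrtr_ge0 ?schatten_ge0//.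
by apply: singular_value_le_schatten; split; rewrite ?sqrtr_ge0// sqr_sqrtr.
Qed.

Lemma schatten_quad n (A : 'M[R]_n) u :
  `|bil A u u| <= sqnorm u * schatten_infty A.
Proof.
rewrite -(@ler_pXn2r _ 2)// ?nnegrE// ?mulr_ge0 ?sqnorm_ge0 ?schatten_ge0//.
rewrite real_normK ?num_real//.
have -> : bil A u u = \sum_i u 0 i * (u *m A^T) 0 i.
  rewrite /bil -mulmxA mxE; apply: eq_bigr => i _; congr (_ * _).
  by rewrite -[A in LHS]trmxK -trmx_mul mxE.
apply: le_trans (cauchy_schwarz _ _) _.
rewrite exprMn expr2 -mulrA ler_wpM2l ?sqnorm_ge0// mulrC schatten_opnorm//.
Qed.

Lemma schatten_entry n (A : 'M[R]_n) i j : `|A i j| <= schatten_infty A.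
Proof.
rewrite -(@ler_pXn2r _ 2)// ?nnegrE ?schatten_ge0// real_normK ?num_real//.
have := schatten_opnorm A (delta_mx 0 j).
rewrite (_ : sqnorm (delta_mx 0 j) = 1) ?mulr1; last first.
  rewrite /sqnorm (bigD1 j)//= mxE !eqxx expr1n big1 ?addr0// => k kj.
  by rewrite mxE eqxx (negbTE kj) expr0n.
apply: le_trans; rewrite /sqnorm (bigD1 i)//= -rowE !mxE lerDl.
by apply: sumr_ge0 => k _; exact: sqr_ge0.
Qed.

(** On rank-one matrices the Frobenius norm bounds the Schatten norm without
    loss, which keeps the constant of the lower bound sharp. *)
Lemma frob_rank1 n c (u : 'rV[R]_n) :
  Num.sqrt (sqfrob (c *: (u^T *m u))) = `|c| * sqnorm u.
Proof.
rewrite (_ : sqfrob _ = (c * sqnorm u) ^+ 2).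
  by rewrite sqrtr_sqr normrM (ger0_norm (sqnorm_ge0 u)).
rewrite exprMn (expr2 (sqnorm u)) /sqfrob {1}/sqnorm mulr_suml mulr_sumr.
apply: eq_bigr => i _; rewrite /sqnorm 2!mulr_sumr; apply: eq_bigr => j _.
by rewrite !mxE big_ord1 !mxE; ring.
Qed.

Lemma bil_rank1 n c (u : 'rV[R]_n) :
  bil (c *: (u^T *m u)) u u = c * sqnorm u ^+ 2.
Proof.
rewrite /bil -scalemxAr -scalemxAl mxE mulmxA -(mulmxA (u *m u^T)) mxE big_ord1.
by rewrite -bil1 /bil mulmx1 expr2.
Qed.

Lemma bilD m n (B C : 'M[R]_(m, n)) u v : bil (B + C) u v = bil B u v + bil C u v.
Proof. by rewrite /bil mulmxDr mulmxDl [LHS]mxE. Qed.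

End matrices.

(** * Convex functions of Lipschitz modulus L *)

Section convexity.
Context {R : realType}.
Implicit Types f : R -> R.

Lemma convex_functionE f : convex_function setT f ->
  forall x y t, 0 <= t <= 1 -> f (t * x + (1 - t) * y) <= t * f x + (1 - t) * f y.
Proof.
move=> cf x y t /andP[t0 t1].
by have := cf (Itv01 t0 t1) x y; rewrite !inE => /(_ I I).
Qed.

Lemma three_chords f a b c : convex_function setT f -> a < b -> b < c ->
  (c - a) * f b <= (c - b) * f a + (b - a) * f c.
Proof.
move=> cf ab bc; have ac : 0 < c - a by lra.
pose t := (c - b) / (c - a).
have t01 : 0 <= t <= 1 by rewrite divr_ge0 ?ler_pdivrMr ?mul1r; lra.
have := convex_functionE cf a c t01.
rewrite (_ : t * a + _ = b); last by rewrite /t; field; rewrite gt_eqF.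
rewrite -(ler_pM2l ac) => /le_trans; apply.
by rewrite le_eqVlt; apply/orP; left; apply/eqP; rewrite /t; field; rewrite gt_eqF.
Qed.

Lemma lipschitzE f K : K.-lipschitz f -> forall x y, `|f x - f y| <= K * `|x - y|.
Proof. by move=> h x y; exact: (h (x, y)). Qed.

Lemma lipschitz_modulus_ge0 f L : lipschitz_modulus f L -> 0 <= L.
Proof.
move=> [/lipschitzE /(_ 1 0)]; rewrite subr0 normr1 mulr1 => + _.
exact: le_trans.
Qed.

Lemma lipschitz_continuous f K : K.-lipschitz f -> continuous f.
Proof.
move=> /lipschitzE lf x; apply/cvgrPdist_le => e e0.
have K1 : 0 < `|K| + 1 by rewrite ltr_wpDl.
near=> y; apply: (le_trans (lf x y)).
apply: (@le_trans _ _ ((`|K| + 1) * `|x - y|)).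
  by rewrite ler_wpM2r// (le_trans (ler_norm _))// lerDl.
rewrite mulrC -ler_pdivlMr//; near: y.
by apply: cvgr_dist_le; [exact: cvg_id|rewrite divr_gt0].
Unshelve. all: by end_near. Qed.

(** Outside the interval from [y] to [x] a convex function lies above the line
    through the two points of its graph; inside, the Lipschitz bound controls
    how far it drops below that line. *)
Lemma chord_minorant f x y L : convex_function setT f -> L.-lipschitz f -> y < x ->
  exists C, forall u, (f x - f y) / (x - y) * u - C <= f u.
Proof.
move=> cf /lipschitzE lf yx; have xy0 : 0 < x - y by lra.
set k := (f x - f y) / (x - y).
have kE : k * (x - y) = f x - f y by rewrite /k divfK// gt_eqF.
exists (k * x - f x + (`|k| + `|L|) * (x - y)) => u.
have L0 : 0 <= (`|k| + `|L|) * (x - y) by apply: mulr_ge0; [exact: addr_ge0|exact: ltW].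
suff [|h] : k * (u - x) + f x <= f u \/ k * (u - x) + f x - (`|k| + `|L|) * (x - y) <= f u.
  lra.
  lra.
have [xu|ux] := ltP x u.
  left; have := three_chords cf yx xu => h.
  rewrite -(ler_pM2l xy0); nra.
have [uy|yu] := ltP u y.
  left; have := three_chords cf uy yx => h.
  rewrite -(ler_pM2l xy0); nra.
right.
have := lf u x; rewrite ler_norml distrC (ger0_norm (_ : 0 <= x - u)) ?subr_ge0//.
move=> /andP[h _].
have h1 : L * (x - u) <= `|L| * (x - y).
  apply: (@le_trans _ _ (`|L| * (x - u))); first by rewrite ler_wpM2r ?subr_ge0// ler_norm.
  by rewrite ler_wpM2l// lerB.
have h2 : k * (u - x) <= `|k| * (x - y).
  rewrite -opprB mulrN -mulNr.
  apply: (@le_trans _ _ (`|k| * (x - u))); first by rewrite ler_wpM2r ?subr_ge0// -normrN ler_norm.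
  by rewrite ler_wpM2l// lerB.
lra.
Qed.

(** Since [L - e] is not a Lipschitz constant, some chord is steeper than it. *)
Lemma steep_minorant f L e : convex_function setT f -> lipschitz_modulus f L ->
  0 < e -> exists k C, L - e < `|k| /\ forall u, k * u - C <= f u.
Proof.
move=> cf [lf minL] e0.
have [x [y [yx h]]] : exists x y, y < x /\ (L - e) * (x - y) < `|f x - f y|.
  apply: contrapT => H; have : L <= L - e; last by rewrite lerDl oppr_ge0 leNgt e0.
  apply: minL => -[x y] _ /=.
  have [yx|xy|->] := ltgtP y x; last by rewrite !subrr !normr0 mulr0.
    rewrite (gtr0_norm (_ : 0 < x - y)) ?subr_gt0// leNgt; apply/negP => h.
    by apply: H; exists x, y.
  rewrite [leLHS]distrC [X in _ * X]distrC (gtr0_norm (_ : 0 < y - x)) ?subr_gt0// leNgt.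
  by apply/negP => h; apply: H; exists y, x.
have [C hC] := chord_minorant cf lf yx.
exists ((f x - f y) / (x - y)), C; split => //.
have xy0 : 0 < x - y by rewrite subr_gt0.
by rewrite normrM normfV (gtr0_norm xy0) ltr_pdivlMr.
Qed.

End convexity.

(** * The loss as a quadratic form *)

Section quad.
Context {R : realType} {d : nat}.

Definition homog (theta : 'cV[R]_d) : 'rV[R]_(d + 1) := row_mx theta^T 1%:M.

Lemma quad_lossE calL (Z : symmx R (d + 1)) theta :
  quad_loss calL Z theta = calL (bil (mxval Z) (homog theta) (homog theta)).
Proof.
rewrite /quad_loss /bil /homog /Ypart /zpart /z0part; congr calL.
case: Z => A /= /eqP AT; rewrite -{4}(submxK A).
have -> : dlsubmx A = (ursubmx A)^T by rewrite trmx_ursub AT.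
rewrite mul_row_block tr_row_mx mul_row_col trmxK trmx1 !mul1mx !mulmx1.
rewrite !mulmxDl !mxE.
have -> : \sum_j theta^T 0 j * ursubmx A j 0
        = \sum_j (ursubmx A)^T 0 j * theta j 0.
  by apply: eq_bigr => j _; rewrite [theta^T _ _]mxE [_^T 0 j]mxE mulrC.
ring.
Qed.

Lemma sqnorm_homog (theta : 'cV[R]_d) :
  sqnorm (homog theta) = norm2 (col_mx theta (1%:M : 'cV[R]_1)) ^+ 2.
Proof.
rewrite /norm2 sqr_sqrtr; last by apply: sumr_ge0 => i _; exact: sqr_ge0.
by apply: eq_bigr => i _; rewrite /homog -[1%:M in LHS]trmx1 -tr_col_mx mxE.
Qed.

Lemma sqnorm_homog_gt0 (theta : 'cV[R]_d) : 0 < sqnorm (homog theta).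
Proof.
rewrite lt_neqAle sqnorm_ge0 andbT eq_sym sqnorm_eq0; apply/eqP => /rowP.
move=> /(_ (rshift d 0)); rewrite row_mxEr !mxE eqxx => /eqP.
by rewrite oner_eq0.
Qed.

(** Take [Y = 0], [z = e / 2] with [e] the first basis vector and [z0 = 0]: the
    loss is then [calL] of the first coordinate of [theta]. *)
Lemma convex_quad_loss (calL : R -> R) : (0 < d)%N ->
  (forall Z : symmx R (d + 1),
     convex_function setT (fun theta : 'cV[R]_d => quad_loss calL Z theta)) ->
  convex_function setT calL.
Proof.
move=> d0 cvx.
pose i0 : 'I_d := Ordinal d0.
pose z : 'cV[R]_d := 2^-1 *: delta_mx i0 0.
have ZT : (block_mx 0 z z^T 0 : 'M[R]_(d + 1))^T == block_mx 0 z z^T 0.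
  by rewrite tr_block_mx !trmx0 trmxK.
have lE x : quad_loss calL (SymMx ZT) (const_mx x) = calL x.
  rewrite /quad_loss /Ypart /zpart /z0part /= block_mxKul block_mxKur block_mxKdr.
  rewrite mulmx0 mul0mx !mxE (bigD1 i0)//= big1 ?addr0 ?add0r.
    by rewrite !mxE !eqxx mulr1 mulrA divff ?mul1r ?pnatr_eq0.
  by move=> i /negbTE ii0; rewrite !mxE ii0 mulr0 mul0r.
move=> t x y _ _; have := cvx (SymMx ZT) t (const_mx x) (const_mx y).
rewrite !inE => /(_ I I) /=; rewrite !lE; apply: le_trans.
rewrite -lE le_eqVlt; apply/orP; left; apply/eqP; congr (quad_loss _ _ _).
by apply/matrixP => i j; rewrite !mxE.
Qed.

End quad.

(** * Integration *)

Section mixture.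
Context d (T : measurableType d) (R : realType).
Variables (t : R) (t0 : 0 <= t) (t1 : 0 <= 1 - t) (m1 m2 : probability T R).

Definition mixture : set T -> \bar R :=
  measure_add (mscale (NngNum t1) m1) (mscale (NngNum t0) m2).

HB.instance Definition _ := Measure.on mixture.

Lemma mixtureE A : mixture A = ((1 - t)%:E * m1 A + t%:E * m2 A)%E.
Proof. by rewrite /mixture measure_addE. Qed.

Lemma mixture_setT : mixture setT = 1%E.
Proof. by rewrite mixtureE !probability_setT !mule1 -EFinD subrK. Qed.

HB.instance Definition _ := Measure_isProbability.Build _ _ _ mixture mixture_setT.

Lemma ge0_integral_mixture (f : T -> \bar R) : measurable_fun setT f ->
  (forall x, 0 <= f x)%E ->
  (\int[mixture]_x f x = (1 - t)%:E * \int[m1]_x f x + t%:E * \int[m2]_x f x)%E.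
Proof.
move=> mf f0; rewrite ge0_integral_measure_add//.
by rewrite !ge0_integral_mscale.
Qed.

Lemma integrable_mixture (f : T -> R) :
  m1.-integrable setT (EFin \o f) -> m2.-integrable setT (EFin \o f) ->
  mixture.-integrable setT (EFin \o f).
Proof.
move=> /integrableP[mf i1] /integrableP[_ i2]; apply/integrableP; split => //.
rewrite ge0_integral_mixture//; last exact: measurableT_comp.
by apply: lte_add_pinfty; apply: lte_mul_pinfty => //; rewrite fin_numE.
Qed.

(** The nonnegative case applied to the positive and negative parts of [f]. *)
Lemma Rintegral_mixture (f : T -> R) :
  m1.-integrable setT (EFin \o f) -> m2.-integrable setT (EFin \o f) ->
  \int[mixture]_x f x = (1 - t) * \int[m1]_x f x + t * \int[m2]_x f x.
Proof.
move=> i1 i2; have [mf _] := integrableP _ _ _ i1.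
apply: EFin_inj; rewrite EFinD !EFinM.
rewrite /Rintegral !fineK; try by apply: integrable_fin_num => //; exact: integrable_mixture.
rewrite (integralE mixture) (integralE m1) (integralE m2).
rewrite !ge0_integral_mixture//; try exact: measurable_funepos; try exact: measurable_funeneg.
have := integrable_pos_fin_num measurableT i1.
have := integrable_neg_fin_num measurableT i1.
have := integrable_pos_fin_num measurableT i2.
have := integrable_neg_fin_num measurableT i2.
rewrite /comp /= => /fineK <- /fineK <- /fineK <- /fineK <-.
by rewrite -!(EFinM, EFinN, EFinD); congr EFin; ring.
Qed.

End mixture.

Section lower_integral.
Context d (T : measurableType d) (R : realType).
Local Open Scope ereal_scope.

Lemma ge0_le_integralT (mu : measure T R) (f g : T -> \bar R) :
  (forall x, 0 <= f x) -> (forall x, f x <= g x) ->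
  \int[mu]_x f x <= \int[mu]_x g x.
Proof.
move=> f0 fg; rewrite !ge0_integralTE//; last by move=> x; exact: le_trans (fg x).
apply: ereal_sup_le => _ [h hf <-]; exists h => //= x.
exact: le_trans (hf x) (fg x).
Qed.

End lower_integral.

Section transfer.
Context d1 d2 (T1 : measurableType d1) (T2 : measurableType d2) (R : realType).
Variables (mu : probability T1 R) (nu : probability T2 R) (phi : T1 -> T2).
Hypothesis mphi : measurable_fun [set: T1] phi.
Hypothesis nuE : forall A, measurable A -> nu A = mu (phi @^-1` A).

Lemma ge0_integral_image (f : T2 -> \bar R) : measurable_fun [set: T2] f ->
  (forall x, 0 <= f x)%E -> (\int[nu]_x f x = \int[mu]_x f (phi x))%E.
Proof.
move=> mf f0; rewrite -[RHS](ge0_integral_pushforward mphi mu measurableT mf)//.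
by apply: eq_measure_integral => A mA _; exact: nuE.
Qed.

Lemma integrable_image (f : T2 -> R) : nu.-integrable setT (EFin \o f) ->
  mu.-integrable setT (EFin \o (f \o phi)).
Proof.
move=> /integrableP[mf fi]; apply/integrableP; split.
  exact: (measurableT_comp mf mphi).
rewrite (ge0_integral_image _)// in fi; exact: measurableT_comp.
Qed.

Lemma Rintegral_image (f : T2 -> R) : nu.-integrable setT (EFin \o f) ->
  \int[nu]_x f x = \int[mu]_x f (phi x).
Proof.
move=> fi; have [mf _] := integrableP _ _ _ fi.
rewrite /Rintegral; congr fine.
have fphi : mu.-integrable (phi @^-1` setT) ((EFin \o f) \o phi).
  by rewrite preimage_setT; exact: integrable_image.
rewrite -[RHS](integral_pushforward mphi mf fphi measurableT).
by apply: eq_measure_integral => A mA _; exact: nuE.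
Qed.

End transfer.

Section affine.
Context d (T : measurableType d) (R : realType) (P : probability T R).
Variables (g : T -> R) (k b : R).
Hypothesis gi : P.-integrable setT (EFin \o g).

Lemma integrable_affine : P.-integrable setT (EFin \o (fun x => k * g x + b)).
Proof.
have -> : EFin \o (fun x => k * g x + b) =
    (fun x => k%:E * (EFin \o g) x)%E \+ (EFin \o cst b) by apply/funext.
apply: integrableD => //; first exact: integrableZl.
exact: finite_measure_integrable_cst.
Qed.

Lemma Rintegral_affine : \int[P]_x (k * g x + b) = k * \int[P]_x g x + b.
Proof.
rewrite RintegralD//; last exact: (finite_measure_integrable_cst P b).
  rewrite RintegralZl// Rintegral_cst// [X in fine X](_ : _ = 1%E) ?mulr1//.
  exact: probability_setT.
exact: (integrableZl measurableT k gi).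
Qed.

End affine.

(** * Borel measurability on symmetric matrices *)

Section borel.
Context {R : realType} {n : nat}.
Local Notation T := (borel_symmx R n).

Lemma open_measurable_symmx (U : set (symmx R n)) :
  open U -> measurable (U : set T).
Proof. by move=> oU; apply: sub_sigma_algebra. Qed.

Lemma measurable_entry i j : measurable_fun [set: T] (fun Z : T => mxval Z i j).
Proof.
apply: (measurability _ (RGenOpens.measurableE R)) => //.
move=> _ [_ [a [b ->]] <-]; rewrite setTI.
suff /open_measurable_symmx : open ((fun Z : symmx R n => mxval Z i j) @^-1` `]a, b[) by exact.
suff : continuous (fun Z : symmx R n => mxval Z i j).
  by move=> /continuousP; apply; exact: interval_open.
move=> Z; apply: (@continuous_comp _ _ _ (@mxval R n) (fun M => M i j)).
  exact: initial_continuous.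
exact: coord_continuous.
Qed.

Lemma add_sym (Z D : symmx R n) : (mxval Z + mxval D)^T == mxval Z + mxval D.
Proof. by case: Z D => [A /eqP AT] [B /eqP BT] /=; rewrite raddfD/= AT BT. Qed.

Definition translate (D : symmx R n) (Z : T) : T := SymMx (add_sym Z D).

(** Translations are continuous, so preimages of open sets are open. *)
Lemma measurable_translate D : measurable_fun [set: T] (translate D).
Proof.
apply: (@measurability _ _ T T setT (translate D) (@open (symmx R n)) erefl).
move=> _ [U oU <-].
rewrite setTI.
suff /open_measurable_symmx : open ((translate D : symmx R n -> symmx R n) @^-1` U) by exact.
suff : continuous (translate D : symmx R n -> symmx R n) by move/continuousP; exact.
apply: continuous_comp_initial => Z /=.
apply: (@continuousD _ _ _ (@mxval R n) (fun=> mxval D)).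
  exact: initial_continuous.
exact: cst_continuous.
Qed.

End borel.

(** * First moments and the Wasserstein distance *)

Section moments.
Context {R : realType} {n : nat}.
Local Notation T := (borel_symmx R n).

Definition entrysum (A : 'M[R]_n) : R := \sum_i \sum_j `|A i j|.

Lemma entrysum_ge0 A : 0 <= entrysum A.
Proof. by apply: sumr_ge0 => i _; exact: sumr_ge0. Qed.

Lemma entrysumD A B : entrysum (A + B) <= entrysum A + entrysum B.
Proof.
rewrite /entrysum -big_split/=; apply: ler_sum => i _.
by rewrite -big_split/=; apply: ler_sum => j _; rewrite mxE ler_normD.
Qed.

Lemma sum_sqr_le (I : finType) (y : I -> R) : (forall i, 0 <= y i) ->
  \sum_i y i ^+ 2 <= (\sum_i y i) ^+ 2.
Proof.
move=> y0; rewrite [leRHS]expr2 mulr_suml; apply: ler_sum => i _.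
rewrite expr2 ler_wpM2l// (bigD1 i)//= lerDl; exact: sumr_ge0.
Qed.

Lemma schatten_le_entrysum A : schatten_infty A <= entrysum A.
Proof.
apply: (le_trans (schatten_le_frob A)).
rewrite -(ger0_norm (entrysum_ge0 A)) -sqrtr_sqr ler_sqrt ?sqr_ge0//.
apply: (le_trans _ (sum_sqr_le _)); last by move=> i; exact: sumr_ge0.
apply: ler_sum => i _; apply: (le_trans _ (sum_sqr_le _)) => //.
by apply: ler_sum => j _; rewrite real_normK ?num_real.
Qed.

Lemma measurable_entrysum : measurable_fun [set: T] (fun Z : T => entrysum (mxval Z)).
Proof.
apply: measurable_sum => i; apply: measurable_sum => j.
by apply: measurableT_comp => //; exact: measurable_entry.
Qed.

(** The Schatten norm lies between the absolute value of any entry and the sum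
    of the absolute values of all entries, and these are measurable. *)
Lemma finite_first_momentP (Q : probability T R) :
  finite_first_moment Q <->
  Q.-integrable setT (EFin \o (fun Z : T => entrysum (mxval Z))).
Proof.
split=> [Qfin|/integrableP[_]].
  have -> : EFin \o (fun Z : T => entrysum (mxval Z)) =
      (fun Z : T => \sum_i \sum_j `|mxval Z i j|%:E)%E.
    apply/funext => Z /=; rewrite /entrysum -sumEFin.
    by apply: eq_bigr => i _; rewrite sumEFin.
  apply: integrable_sum => // i _; apply: integrable_sum => // j _.
  have mij : measurable_fun [set: T] (EFin \o (fun Z : T => `|mxval Z i j|)).
    apply/measurable_EFinP/measurableT_comp => //; exact: measurable_entry.
  apply/integrableP; split => //.
  apply: le_lt_trans Qfin; apply: ge0_le_integralT => // Z /=.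
  by rewrite lee_fin normr_id schatten_entry.
apply: le_lt_trans; apply: ge0_le_integralT => Z /=; rewrite lee_fin ?schatten_ge0//.
by rewrite ger0_norm ?entrysum_ge0// schatten_le_entrysum.
Qed.

Lemma integrable_growth (Q : probability T R) (f : T -> R) c K :
  finite_first_moment Q -> measurable_fun [set: T] f ->
  (forall Z, `|f Z| <= c + K * entrysum (mxval Z)) ->
  Q.-integrable setT (EFin \o f).
Proof.
move=> /finite_first_momentP Qi mf fle.
apply: (@le_integrable _ _ _ _ _ _ _ (EFin \o (fun Z : T => c + K * entrysum (mxval Z)))) => //.
- exact/measurable_EFinP.
- by move=> Z _ /=; rewrite lee_fin (le_trans (fle Z))// ler_norm.
under [X in EFin \o X]eq_fun do rewrite addrC.
exact: integrable_affine.
Qed.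

(** The easy half of Kantorovich-Rubinstein duality: for a coupling [pi],
    [E_Q f - E_P f] is the [pi]-integral of [f Z - f Z'], which is at most [K]
    times the transport cost. *)
Lemma wasserstein_lipschitz (P Q : probability T R) rho (f : T -> R) K :
  0 <= K -> (forall Z Z', `|f Z - f Z'| <= K * schatten_infty (mxval Z - mxval Z')) ->
  P.-integrable setT (EFin \o f) -> Q.-integrable setT (EFin \o f) ->
  (W1 Q P <= rho%:E)%E ->
  \int[Q]_Z f Z <= \int[P]_Z f Z + K * rho.
Proof.
move=> K0 flip Pf Qf W1le; rewrite -lerBlDl; apply/ler_addgt0Pr => e e0.
have K1 : 0 < K + 1 by rewrite ltr_wpDl.
have : (W1 Q P < (rho + e / (K + 1))%:E)%E.
  by apply: (le_lt_trans W1le); rewrite lte_fin ltrDl divr_gt0.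
move=> /ereal_inf_lt[_ [pi cpi <-] cost].
have mfst : measurable_fun [set: T * T] (@fst T T) by exact: measurable_fst.
have msnd : measurable_fun [set: T * T] (@snd T T) by exact: measurable_snd.
have Qpi A : measurable A -> Q A = pi (fst @^-1` A).
  by move=> /cpi[<- _]; congr (pi _); apply/seteqP; split => x /=; tauto.
have Ppi A : measurable A -> P A = pi (snd @^-1` A).
  by move=> /cpi[_ <-]; congr (pi _); apply/seteqP; split => x /=; tauto.
have i1 := integrable_image mfst Qpi Qf.
have i2 := integrable_image msnd Ppi Pf.
have i12 : pi.-integrable setT (EFin \o (fun x : T * T => f x.1 - f x.2)).
  exact: (integrableB measurableT i1 i2).
pose g (x : T * T) := `|f x.1 - f x.2| / K.
have g0 x : 0 <= g x by rewrite divr_ge0.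
(* If [K = 0] then [g = 0], as [0^-1 = 0], and [f] is constant. *)
have gK x : `|f x.1 - f x.2| = K * g x.
  have [K00|Kn0] := eqVneq K 0; last by rewrite /g mulrC divfK.
  by have := flip x.1 x.2; rewrite K00 !mul0r normr_le0 => /eqP ->; rewrite normr0.
have gcost x : g x <= schatten_infty (mxval x.1 - mxval x.2).
  have [K00|Kn0] := eqVneq K 0; first by rewrite /g K00 invr0 mulr0 schatten_ge0.
  by rewrite /g ler_pdivrMr 1?mulrC ?flip// lt_neqAle eq_sym Kn0.
have mg : measurable_fun [set: T * T] g.
  apply: measurable_funM => //; apply: measurableT_comp => //.
  by have [/measurable_EFinP] := integrableP _ _ _ i12.
have intg : (\int[pi]_x (g x)%:E < (rho + e / (K + 1))%:E)%E.
  by apply: le_lt_trans cost; apply: ge0_le_integralT => x; rewrite lee_fin.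
have gi : pi.-integrable setT (EFin \o g).
  apply/integrableP; split; first exact/measurable_EFinP.
  apply: (lt_trans _ (ltry _)); apply: le_lt_trans intg; apply: ge0_le_integralT => x //=.
  by rewrite lee_fin ger0_norm.
rewrite (Rintegral_image mfst Qpi Qf) (Rintegral_image msnd Ppi Pf).
rewrite -RintegralB//.
apply: (@le_trans _ _ (\int[pi]_x (K * g x))).
  apply: le_Rintegral => //; first exact: (integrableZl measurableT K gi).
  by move=> x _; rewrite -gK ler_norm.
rewrite RintegralZl//.
have : \int[pi]_x g x <= rho + e / (K + 1).
  by rewrite -lee_fin fineK ?integrable_fin_num// ltW.
move=> /(ler_wpM2l K0) /le_trans; apply.
rewrite mulrDr lerD2l mulrCA ler_piMr ?ltW// ltr_pdivrMr// mul1r.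
by rewrite ltrDl.
Qed.

End moments.

(** * Moving a fraction of the mass *)

Section perturbation.
Context {R : realType} {n : nat}.
Local Notation T := (borel_symmx R n).

Definition diag (Z : T) : T * T := (Z, Z).
Definition translate_pair (D : symmx R n) (Z : T) : T * T := (translate D Z, Z).

Lemma measurable_diag : measurable_fun [set: T] diag.
Proof. exact: measurable_fun_pair. Qed.

Lemma measurable_translate_pair D : measurable_fun [set: T] (translate_pair D).
Proof. by apply: measurable_fun_pair => //; exact: measurable_translate. Qed.

HB.instance Definition _ (D : symmx R n) :=
  isMeasurableFun.Build _ _ _ _ (translate D) (measurable_translate D).
HB.instance Definition _ := isMeasurableFun.Build _ _ _ _ diag measurable_diag.
HB.instance Definition _ (D : symmx R n) :=
  isMeasurableFun.Build _ _ _ _ (translate_pair D) (measurable_translate_pair D).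

Variables (P : probability T R) (t : R) (t0 : 0 <= t) (t1 : 0 <= 1 - t).
Variable D : symmx R n.
Hypothesis Pfin : finite_first_moment P.

Definition perturbation : probability T R :=
  mixture t0 t1 P (distribution P (translate D)).

Definition transport : probability (T * T)%type R :=
  mixture t0 t1 (distribution P diag) (distribution P (translate_pair D)).

Lemma coupling_transport : coupling perturbation P transport.
Proof.
move=> A mA; split; rewrite [LHS]mixtureE.
  rewrite [RHS]mixtureE; congr (_ * _ + _ * _)%E; rewrite /distribution /pushforward;
  by congr (P _); apply/seteqP; split => x /=; tauto.
rewrite [X in (_ * X + _)%E](_ : _ = P A); last first.
  by rewrite /distribution /pushforward; congr (P _); apply/seteqP; split => x /=; tauto.
rewrite [X in (_ + _ * X)%E](_ : _ = P A); last first.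
  by rewrite /distribution /pushforward; congr (P _); apply/seteqP; split => x /=; tauto.
by rewrite -ge0_muleDl ?lee_fin// -EFinD subrK mul1e.
Qed.

Let frobdist (x : T * T) := Num.sqrt (sqfrob (mxval x.1 - mxval x.2)).

Let measurable_frobdist : measurable_fun [set: T * T] frobdist.
Proof.
apply: (measurableT_comp (continuous_measurable_fun (@sqrt_continuous R))).
apply: measurable_sum => i; apply: measurable_sum => j.
apply: measurable_funX; under eq_fun do rewrite !mxE.
apply: measurable_funB.
  exact: (measurableT_comp (measurable_entry i j) measurable_fst).
exact: (measurableT_comp (measurable_entry i j) measurable_snd).
Qed.

(** The plan [transport] leaves the mass [1 - t] in place and moves the mass [t]
    by the constant matrix [D]. *)
Lemma W1_perturbation : (W1 perturbation P <= (t * Num.sqrt (sqfrob (mxval D)))%:E)%E.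
Proof.
apply: (@le_trans _ _ (\int[transport]_x (frobdist x)%:E)%E).
  apply: (@le_trans _ _ (\int[transport]_x
      (schatten_infty (mxval x.1 - mxval x.2))%:E)%E).
    by apply: ereal_inf_lbound; exists transport => //; exact: coupling_transport.
  by apply: ge0_le_integralT => x; rewrite lee_fin ?schatten_ge0 ?schatten_le_frob.
have mf : measurable_fun [set: T * T] (EFin \o frobdist) by exact/measurable_EFinP.
have f0 x : (0 <= (EFin \o frobdist) x)%E by rewrite lee_fin sqrtr_ge0.
rewrite (ge0_integral_mixture t0 t1 _ _ mf f0).
rewrite (@ge0_integral_image _ _ _ _ _ P (distribution P diag) _
  measurable_diag (fun _ _ => erefl) _ mf f0).
rewrite (@ge0_integral_image _ _ _ _ _ P (distribution P (translate_pair D)) _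
  (measurable_translate_pair D) (fun _ _ => erefl) _ mf f0).
rewrite /frobdist /=.
under eq_integral do rewrite subrr.
rewrite [X in ((1 - t)%:E * X)%E](_ : _ = 0)%E; last first.
  rewrite (_ : sqfrob 0 = 0) ?sqrtr0 ?integral0//.
  by rewrite /sqfrob big1// => i _; rewrite big1// => j _; rewrite mxE expr0n.
under eq_integral do rewrite addrAC subrr add0r.
rewrite mule0 add0e integral_cst//.
by rewrite [X in (_ * (_ * X))%E](_ : _ = 1%E) ?mule1 ?EFinM//; exact: probability_setT.
Qed.

Lemma integrable_translate (f : T -> R) : measurable_fun [set: T] f ->
  P.-integrable setT (EFin \o (f \o translate D)) ->
  (distribution P (translate D)).-integrable setT (EFin \o f).
Proof.
move=> mf fi; apply: (integrable_pushforward (measurable_translate D)) => //.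
exact/measurable_EFinP.
Qed.

Lemma finite_first_moment_translate : finite_first_moment (distribution P (translate D)).
Proof.
apply/finite_first_momentP; apply: integrable_translate measurable_entrysum _.
apply: (@integrable_growth _ _ _ _ (entrysum (mxval D)) 1 Pfin).
  exact: (measurableT_comp measurable_entrysum (measurable_translate D)).
move=> Z /=; rewrite mul1r ger0_norm ?entrysum_ge0// addrC; exact: entrysumD.
Qed.

Lemma finite_first_moment_perturbation : finite_first_moment perturbation.
Proof.
apply/finite_first_momentP/integrable_mixture; apply/finite_first_momentP => //.
exact: finite_first_moment_translate.
Qed.

Lemma Rintegral_perturbation (f : T -> R) :
  P.-integrable setT (EFin \o f) ->
  (distribution P (translate D)).-integrable setT (EFin \o f) ->
  \int[perturbation]_Z f Z = (1 - t) * \int[P]_Z f Z + t * \int[P]_Z f (translate D Z).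
Proof.
move=> Pf Df; rewrite (Rintegral_mixture t0 t1 Pf Df).
by rewrite (@Rintegral_image _ _ _ _ _ P (distribution P (translate D)) _
  (measurable_translate D) (fun _ _ => erefl) _ Df).
Qed.

End perturbation.

(** * Worst-case expectations *)

Section duality.
Context {R : realType} {n : nat}.
Local Notation T := (borel_symmx R n).
Variables (f : R -> R) (L : R) (u : 'rV[R]_n).
Hypotheses (cf : convex_function setT f) (fL : lipschitz_modulus f L).

Let q (Z : T) := bil (mxval Z) u u.

Let L0 : 0 <= L. Proof. exact: lipschitz_modulus_ge0 fL. Qed.

Lemma measurable_quad : measurable_fun [set: T] q.
Proof.
rewrite (_ : q = fun Z => \sum_j (\sum_i u 0 i * mxval Z i j) * u 0 j); last first.
  apply/funext => Z; rewrite /q /bil mxE; apply: eq_bigr => j _.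
  by rewrite [u^T _ _]mxE; congr (_ * _); rewrite mxE.
apply: measurable_sum => j; apply: measurable_funM => //.
apply: measurable_sum => i; apply: measurable_funM => //.
exact: measurable_entry.
Qed.

Lemma measurable_loss : measurable_fun [set: T] (f \o q).
Proof.
apply: measurableT_comp measurable_quad; apply: continuous_measurable_fun.
have [lf _] := fL; exact: lipschitz_continuous lf.
Qed.

Lemma quad_lipschitz (Z Z' : T) :
  `|q Z - q Z'| <= sqnorm u * schatten_infty (mxval Z - mxval Z').
Proof. by rewrite /q -bilB; exact: schatten_quad. Qed.

Lemma loss_lipschitz (Z Z' : T) :
  `|f (q Z) - f (q Z')| <= L * sqnorm u * schatten_infty (mxval Z - mxval Z').
Proof.
have [/lipschitzE lf _] := fL; apply: (le_trans (lf _ _)).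
by rewrite -mulrA ler_wpM2l// quad_lipschitz.
Qed.

Lemma integrable_quad (Q : probability T R) : finite_first_moment Q ->
  Q.-integrable setT (EFin \o q).
Proof.
move=> Qfin; apply: (integrable_growth (c := 0) (K := sqnorm u) Qfin measurable_quad).
move=> Z; rewrite add0r (le_trans (schatten_quad _ _))//.
by rewrite ler_wpM2l ?sqnorm_ge0// schatten_le_entrysum.
Qed.

Lemma integrable_loss (Q : probability T R) : finite_first_moment Q ->
  Q.-integrable setT (EFin \o (f \o q)).
Proof.
move=> Qfin; apply: (integrable_growth (c := `|f 0|) (K := L * sqnorm u) Qfin measurable_loss).
move=> Z; have [/lipschitzE lf _] := fL.
rewrite -[f \o q]/(fun Z => f (q Z)) -[X in `|X|](subrK (f 0)) addrC.
rewrite (le_trans (ler_normD _ _))// lerD2l (le_trans (lf _ _))// subr0 -mulrA.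
rewrite ler_wpM2l// (le_trans (schatten_quad _ _))//.
by rewrite ler_wpM2l ?sqnorm_ge0// schatten_le_entrysum.
Qed.

(** The loss is Lipschitz in [Z] with constant [L * sqnorm u]. *)
Lemma worst_case_le (P Q : probability T R) rho : finite_first_moment P ->
  wasserstein_ball rho P Q ->
  \int[Q]_Z f (q Z) <= \int[P]_Z f (q Z) + rho * L * sqnorm u.
Proof.
move=> Pfin [Qfin W1Q]; rewrite -mulrA mulrC.
apply: wasserstein_lipschitz loss_lipschitz (integrable_loss Pfin)
  (integrable_loss Qfin) W1Q.
by rewrite mulr_ge0 ?sqnorm_ge0.
Qed.

(** A fraction [t] of the mass is moved by [(c / t) u^T u], with
    [c = sg k * rho / |u|^2] for the slope [k] of an affine minorant of [f]. The gain is [|k| * rho * |u|^2] and the error is at most [t * M]; the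
    slope and [t] are chosen so that each loses at most [e / 2]. *)
Lemma worst_case_approx (P : probability T R) rho e : finite_first_moment P ->
  0 <= rho -> 0 < sqnorm u -> 0 < e ->
  exists2 Q, wasserstein_ball rho P Q &
    \int[P]_Z f (q Z) + rho * L * sqnorm u - e <= \int[Q]_Z f (q Z).
Proof.
move=> Pfin rho0 u0 e0.
pose s := sqnorm u; pose a := \int[P]_Z f (q Z); pose m := \int[P]_Z q Z.
have rs0 : 0 <= rho * s by rewrite mulr_ge0// ltW.
have [|k [C [kL fk]]] := @steep_minorant _ f L (e / (2 * (rho * s + 1))) cf fL.
  by rewrite divr_gt0// mulr_gt0//; lra.
pose M := `|a| + `|k * m - C| + 1.
have M0 : 0 < M by rewrite ltr_wpDl// addr_ge0.
pose t := Num.min 1 (e / (2 * M)).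
have t0 : 0 < t by rewrite lt_min ltr01 divr_gt0// mulr_gt0.
have t1 : 0 <= 1 - t by rewrite subr_ge0 ge_min lexx.
have tM : t * M <= e / 2.
  apply: (@le_trans _ _ (e / (2 * M) * M)); first by rewrite ler_wpM2r ?(ltW M0)// /t ge_min lexx orbT.
  by rewrite le_eqVlt; apply/orP; left; apply/eqP; field; rewrite gt_eqF.
pose c := Num.sg k * rho / s.
have DT : ((c / t) *: (u^T *m u))^T == (c / t) *: (u^T *m u).
  by rewrite linearZ/= trmx_mul trmxK.
pose D : symmx R n := SymMx DT.
exists (perturbation P (ltW t0) t1 D).
  split; first exact: finite_first_moment_perturbation.
  apply: (le_trans (W1_perturbation _ _ _ _)).
  rewrite lee_fin frob_rank1 !normrM !normfV (gtr0_norm t0) (gtr0_norm u0).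
  rewrite (ger0_norm rho0).
  rewrite [leLHS](_ : _ = `|Num.sg k| * rho); last by field; rewrite !gt_eqF.
  by rewrite ler_piMl// normr_sg lern1 leq_b1.
have Dfin := finite_first_moment_translate D Pfin.
rewrite (Rintegral_perturbation _ _ (integrable_loss Pfin) (integrable_loss Dfin)).
rewrite -/a.
have qD Z : q (translate D Z) = q Z + c / t * s ^+ 2.
  by rewrite /q /= bilD bil_rank1.
have kc : k * (c * s ^+ 2) = `|k| * (rho * s).
  by rewrite /c normrEsg; field; rewrite gt_eqF.
have lb : k * (m + c / t * s ^+ 2) - C <= \int[P]_Z f (q (translate D Z)).
  rewrite [leLHS](_ : _ = k * m + (k * (c / t * s ^+ 2) - C)); last by ring.
  rewrite -(Rintegral_affine _ _ (integrable_quad Pfin)).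
  apply: le_Rintegral => //; first exact: integrable_affine (integrable_quad Pfin).
    exact: (@integrable_image _ _ _ _ _ P (distribution P (translate D)) _
      (measurable_translate D) (fun _ _ => erefl) _ (integrable_loss Dfin)).
  by move=> Z _; rewrite qD (le_trans _ (fk _))// mulrDr addrA.
apply: (@le_trans _ _ ((1 - t) * a + t * (k * (m + c / t * s ^+ 2) - C))); last first.
  by rewrite lerD2l ler_wpM2l// ltW.
have -> : t * (k * (m + c / t * s ^+ 2) - C) = t * (k * m - C) + k * (c * s ^+ 2).
  by field; rewrite gt_eqF.
rewrite kc.
have h1 : t * a <= t * `|a| by rewrite ler_wpM2l ?ler_norm// ltW.
have h2 : - (t * (k * m - C)) <= t * `|k * m - C|.
  by rewrite -mulrN ler_wpM2l ?(ltW t0)// -normrN ler_norm.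
have h3 : t * `|a| + t * `|k * m - C| <= e / 2.
  apply: le_trans tM; rewrite /M !mulrDr mulr1 lerDl ltW//.
have h4 : (L - e / (2 * (rho * s + 1))) * (rho * s) <= `|k| * (rho * s).
  by rewrite ler_wpM2r// ltW.
have h5 : e / (2 * (rho * s + 1)) * (rho * s) <= e / 2.
  rewrite [leLHS](_ : _ = e / 2 * ((rho * s) / (rho * s + 1))); last first.
    by field; rewrite gt_eqF//; lra.
  rewrite ler_piMr//; first by rewrite divr_ge0// ltW.
  by rewrite ler_pdivrMr ?mul1r ?lerDl//; lra.
rewrite -/s; clear -h1 h2 h3 h4 h5; lra.
Qed.

Lemma strong_duality (P : probability T R) rho : finite_first_moment P ->
  0 <= rho -> 0 < sqnorm u ->
  ereal_sup [set 'E_Q[fun Z : T => f (q Z)]%E | Q in wasserstein_ball rho P] =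
  ('E_P[fun Z : T => f (q Z)] + (rho * L * sqnorm u)%:E)%E.
Proof.
move=> Pfin rho0 u0.
have EE Q : finite_first_moment Q ->
    'E_Q[fun Z : T => f (q Z)]%E = (\int[Q]_Z f (q Z))%:E.
  move=> Qfin; rewrite unlock fineK//.
  by apply: integrable_fin_num => //; exact: integrable_loss.
rewrite (EE P Pfin) -EFinD; apply/eqP; rewrite eq_le; apply/andP; split.
  apply: ge_ereal_sup => _ [Q ballQ <-]; rewrite (EE Q (proj1 ballQ)) lee_fin.
  exact: worst_case_le.
apply/lee_addgt0Pr => e e0.
have [Q ballQ Qe] := worst_case_approx Pfin rho0 u0 e0.
rewrite -leeBlDr// -EFinB; apply: (@le_trans _ _ (\int[Q]_Z f (q Z))%:E).
  by rewrite lee_fin.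
by rewrite -(EE Q (proj1 ballQ)); apply: ereal_sup_ubound; exists Q.
Qed.

End duality.

(** * Robust risk and Tikhonov regularization *)

(** The sum of absolute values of entries is almost surely at most the sum [M]
    of its values at the atoms. *)
Lemma finite_support_moment (R : realType) (n S : nat)
    (P : probability (borel_symmx R n) R) (p : 'I_S -> R)
    (Z : 'I_S -> borel_symmx R n) :
  (forall A : set (borel_symmx R n), measurable A ->
     P A = (\sum_s (p s)%:E * \d_(Z s) A)%E) ->
  finite_first_moment P.
Proof.
move=> PE.
set g := fun X : borel_symmx R n => entrysum (mxval X).
have g0 X : 0 <= g X by exact: entrysum_ge0.
have mg : measurable_fun setT g by exact: measurable_entrysum.
pose M := \sum_s g (Z s).
have M0 : 0 <= M by exact: sumr_ge0.
have PN : P (g @^-1` `]M, +oo[) = 0%E.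
  rewrite PE; last by rewrite -[X in measurable X]setTI; exact: mg.
  apply: big1 => s _; rewrite diracE memNset ?mule0//= in_itv/= andbT.
  apply/negP; rewrite -leNgt /M (bigD1 s)//= lerDl; exact: sumr_ge0.
apply/finite_first_momentP/integrableP; split; first exact/measurable_EFinP.
apply: (@le_lt_trans _ _ (\int[P]_X (cst M%:E) X)%E); last first.
  rewrite integral_cst// [X in (_ * X)%E](_ : _ = 1%E) ?mule1 ?ltry//.
  exact: probability_setT.
apply: ae_ge0_le_integral => //=.
- exact/measurable_EFinP/measurableT_comp.
exists (g @^-1` `]M, +oo[); split=> //.
  by rewrite -[X in measurable X]setTI; exact: mg.
move=> X /= /not_implyP[_ /negP]; rewrite lee_fin ger0_norm ?g0 //.
by rewrite in_itv/= andbT ltNge.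
Qed.

Unset Implicit Arguments.
Set Strict Implicit.

Theorem mainTheorem1 (R : realType) (d S : nat) (hd : (0 < d)%N)
  (Theta : set 'cV[R]_d)
  (calL : R -> R) (L : R) (hL : lipschitz_modulus calL L)
  (* The first alternative is the standing assumption; since Z ranges over the
     whole space, it forces calL to be constant, hence the second, weaker one. *)
  (hconv : (forall Z : symmx R (d + 1),
              convex_function setT (fun theta : 'cV[R]_d => quad_loss calL Z theta))
           \/ convex_function setT calL)
  (phat : 'I_S -> 'cV[R]_d -> R)
  (Zhat : 'I_S -> 'cV[R]_d -> borel_symmx R (d + 1))
  (Phat : 'cV[R]_d -> probability (borel_symmx R (d + 1)) R)
  (hphat0 : forall theta, Theta theta -> forall s, 0 <= phat s theta)
  (hphat1 : forall theta, Theta theta -> \sum_s phat s theta = 1)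
  (hPhat : forall theta, Theta theta ->
     forall A : set (borel_symmx R (d + 1)), measurable A ->
       Phat theta A = (\sum_s (phat s theta)%:E * \d_(Zhat s theta) A)%E)
  (theta_t : 'cV[R]_d) (htheta_t : Theta theta_t)
  (rho : R) (hrho : 0 <= rho) :
  equivalent_problems Theta
    (robust_risk calL rho (Phat theta_t))
    (tikhonov_risk calL L rho (Phat theta_t)).
Proof.
have cf : convex_function setT calL.
  by case: hconv => // cvx; exact: convex_quad_loss cvx.
have Pfin := finite_support_moment (hPhat _ htheta_t).
have FG : robust_risk calL rho (Phat theta_t) = tikhonov_risk calL L rho (Phat theta_t).
  apply/funext => theta; rewrite /robust_risk /tikhonov_risk -sqnorm_homog.
  have lossE : (fun Z : borel_symmx R (d + 1) => quad_loss calL Z theta) =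
      fun Z => calL (bil (mxval Z) (homog theta) (homog theta)).
    by apply/funext => Z; exact: quad_lossE.
  rewrite lossE.
  exact: (strong_duality cf hL Pfin hrho (sqnorm_homog_gt0 theta)).
by rewrite /equivalent_problems FG.
Qed.
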